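(* For every $\varepsilon>0$ and integer $k \ge 2$ there is an $\eta>0$ such that for all sufficiently large $n$ the following holds: if $\mathcal{F}$ is a family of subsets of $[n]$ of size $m := |\mathcal{F}| \ge (1-\eta)k2^{n/k}$ with $\operatorname{dp}(\mathcal{F}) \ge (1-\frac{1}{k}-\eta)\frac{m^2}{2}$, then $k$ divides $n$ and there is a balanced series of $k$ cubes over $[n]$ that contains all but at most $\varepsilon m$ members of $\mathcal{F}$.
   Context: For a family $\mathcal{G}$ of subsets of $[n]=\{1,\ldots,n\}$, $\operatorname{dp}(\mathcal{G})$ is the number of unordered pairs $\{A,B\}$ with $A,B\in\mathcal{G}$ and $A\cap B=\emptyset$ (where $A=B=\emptyset$ is allowed and counted as one pair). A balanced series of $k$ cubes over $[n]$ is a family $\bigcup_{i=1}^k \{A : A \subseteq S_i\}$ where $S_1,\ldots,S_k$ is a partition of $[n]$ with $\lfloor n/k\rfloor \le |S_i| \le \lceil n/k\rceil$ for each $i$. *)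

(* Defs.v *)
From mathcomp Require Import all_boot.
From Stdlib Require Import Reals.
Set Implicit Arguments. Unset Strict Implicit. Unset Printing Implicit Defensive.

(* dp G: number of unordered pairs {A,B} (as the finite set [set A; B]) with
   A, B in G and A, B disjoint.  {A,A} only occurs for A = set0. *)
Definition dp (n : nat) (G : {set {set 'I_n}}) : nat :=
  #|[set P : {set {set 'I_n}} |
      [exists A in G, exists B in G, [disjoint A & B] && (P == [set A; B])]]|.

Definition balanced_partition (n k : nat) (S : 'I_k -> {set 'I_n}) : Prop :=
  (forall i j : 'I_k, i != j -> [disjoint S i & S j]) /\
  (\bigcup_(i < k) S i = [set: 'I_n]) /\
  (forall i : 'I_k, n %/ k <= #|S i| <= (n + k - 1) %/ k).

Definition cube_series (n k : nat) (S : 'I_k -> {set 'I_n}) : {set {set 'I_n}} :=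
  \bigcup_(i < k) powerset (S i).

(* Main.v *)
(* Let m = |F| and call two members of F adjacent when they are disjoint.

   Few (k+1)-cliques.  If a positive proportion of the (k+1)-tuples of F were
   pairwise disjoint, convexity would allow one coordinate after another to be
   replaced by the union of t members of F.  As m >= 2^(n/k), for
   t = 2k(k+1) almost all such unions have more than n/(k+1) elements, so k+1 of
   them cannot be disjoint.

   Partition.  The Moon-Moser inequalities give many k-cliques x, and an averaging
   argument gives one for which the common neighbourhoods Q_i of the k subcliques
   of size k-1 cover almost all of F, nearly without overlaps and with few edges
   inside.  Comparing edge counts, |Q_i| is about m/k and almost all pairs between
   different Q_i are disjoint.

   Cubes.  Let S_i be the set of elements lying in a positive proportion of Q_i.
   The S_i are disjoint, and almost every member of Q_i avoids the other S_j.
   Elements of the rest Z are rare in every Q_i, so an entropy-type bound gives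
   |Q_i| <= (1 + o(1)) 2^|S_i| c^|Z| with c^k <= 3/2.  Multiplying over i,
   (7/8) 2^n <= 2^(n - |Z|) (3/2)^|Z|, whence Z is empty; then
   |Q_i| <= (1 + o(1)) 2^|S_i| forces k |S_i| = n for every i. *)

Require Import Defs.
From mathcomp Require Import all_boot all_order all_algebra.
From mathcomp Require Import archimedean ring lra zify.
From mathcomp Require Import reals sequences exp.
Set Implicit Arguments. Unset Strict Implicit. Unset Printing Implicit Defensive.
Import Order.TTheory GRing.Theory Num.Theory.

(** * Cliques in a finite graph *)

Section Cliques.
Variables (V : finType) (e : rel V).

Definition common r (y : {ffun 'I_r -> V}) : {set V} :=
  [set v | [forall i, e v (y i)]].

(** Cliques are ordered tuples, so [ncliques e 2] counts both orientations of an edge. A vertex with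
    a loop, such as the empty set in the disjointness graph, may be repeated. *)
Definition clique r (x : {ffun 'I_r -> V}) : bool :=
  [forall i, forall j, (i != j) ==> e (x i) (x j)].

Definition del r (i : 'I_r.+1) (x : {ffun 'I_r.+1 -> V}) : {ffun 'I_r -> V} :=
  [ffun j => x (lift i j)].

Definition ins r (i : 'I_r.+1) (v : V) (y : {ffun 'I_r -> V}) :
    {ffun 'I_r.+1 -> V} :=
  [ffun j => if unlift i j is Some j' then y j' else v].

Definition ncliques r : nat := #|[set x : {ffun 'I_r -> V} | clique x]|.

Definition arcs (A B : {set V}) : nat := \sum_(a in A) \sum_(b in B) e a b.

Lemma ins_lift r (i : 'I_r.+1) v y j : ins i v y (lift i j) = y j.
Proof. by rewrite ffunE liftK. Qed.

Lemma ins_id r (i : 'I_r.+1) v y : ins i v y i = v.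
Proof. by rewrite ffunE unlift_none. Qed.

Lemma del_ins r (i : 'I_r.+1) v y : del i (ins i v y) = y.
Proof. by apply/ffunP => j; rewrite ffunE ins_lift. Qed.

Lemma ins_del r (i : 'I_r.+1) (x : {ffun 'I_r.+1 -> V}) : ins i (x i) (del i x) = x.
Proof.
apply/ffunP => j; case: (unliftP i j) => [j'|] ->; last by rewrite ins_id.
by rewrite ins_lift ffunE.
Qed.

Lemma sum_ins r (i : 'I_r.+1) (P : pred {ffun 'I_r.+1 -> V})
    (G : {ffun 'I_r.+1 -> V} -> nat) :
  \sum_(x | P x) G x = \sum_y \sum_(v | P (ins i v y)) G (ins i v y).
Proof.
rewrite pair_big_dep /= (reindex (fun p => ins i p.2 p.1)) //=.
exists (fun x => (del i x, x i)) => [[y v] _|x _] /=.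
  by rewrite del_ins ins_id.
by rewrite ins_del.
Qed.

Hypothesis e_sym : symmetric e.

Lemma clique_ins r (i : 'I_r.+1) v y :
  clique (ins i v y) = clique y && (v \in common y).
Proof.
apply/idP/andP => [/'forall_forallP H|[/'forall_forallP H]].
  split; last first.
    rewrite inE; apply/forallP => j.
    by have := H i (lift i j); rewrite neq_lift ins_id ins_lift.
  apply/'forall_forallP => j j'.
  have := H (lift i j) (lift i j').
  by rewrite !ins_lift (inj_eq (@lift_inj _ i)).
rewrite inE => /forallP Hv; apply/'forall_forallP => j j'.
case: (unliftP i j) => [a|] ->; case: (unliftP i j') => [b|] ->;
  rewrite ?ins_lift ?ins_id ?eqxx //.
- by rewrite (inj_eq (@lift_inj _ i)) H.
- by rewrite e_sym Hv implybT.
- by rewrite Hv implybT.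
Qed.

Lemma sum_clique_ins r (i : 'I_r.+1) (G : {ffun 'I_r.+1 -> V} -> nat) :
  \sum_(x | clique x) G x =
  \sum_(y | clique y) \sum_(v in common y) G (ins i v y).
Proof.
rewrite (sum_ins i) [RHS]big_mkcond; apply: eq_bigr => y _.
under eq_bigl do rewrite clique_ins.
by case: (clique y) => //=; rewrite big_pred0.
Qed.

Lemma ncliques0 : ncliques 0 = 1.
Proof.
rewrite /ncliques -[RHS](_ : #|{ffun 'I_0 -> V}| = 1); last first.
  by rewrite card_ffun card_ord.
by rewrite cardsE; apply: eq_card => x; rewrite !inE; apply/'forall_forallP => -[].
Qed.

Lemma ncliquesE r : ncliques r = \sum_(x : {ffun 'I_r -> V} | clique x) 1.
Proof. by rewrite /ncliques cardsE sum1_card. Qed.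

Lemma sum_clique0 c : \sum_(y : {ffun 'I_0 -> V} | clique y) c = c.
Proof.
rewrite -[RHS]mul1n -ncliques0 ncliquesE big_distrl /=.
by apply: eq_bigr => y _; rewrite mul1n.
Qed.

Lemma ncliquesS r :
  ncliques r.+1 = \sum_(y : {ffun 'I_r -> V} | clique y) #|common y|.
Proof.
rewrite ncliquesE (sum_clique_ins ord0); apply: eq_bigr => y _.
by rewrite sum1_card.
Qed.

Lemma ncliques1 : ncliques 1 = #|V|.
Proof.
rewrite ncliquesS (eq_bigr (fun=> #|V|)) => [|y _].
  exact: sum_clique0.
by apply: eq_card => v; rewrite !inE; apply/forallP => -[].
Qed.

Lemma common_ins r (i : 'I_r.+1) v y w :
  (w \in common (ins i v y)) = e w v && (w \in common y).
Proof.
rewrite !inE; apply/forallP/andP => [H|[Hv /forallP H] j].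
  split; first by have := H i; rewrite ins_id.
  by apply/forallP => j; have := H (lift i j); rewrite ins_lift.
by case: (unliftP i j) => [a|] ->; rewrite ?ins_lift ?ins_id.
Qed.

Lemma ncliquesSS r :
  ncliques r.+2 =
  \sum_(y : {ffun 'I_r -> V} | clique y) arcs (common y) (common y).
Proof.
rewrite ncliquesS (sum_clique_ins ord0); apply: eq_bigr => y _.
apply: eq_bigr => v _; rewrite -sum1_card big_mkcond [RHS]big_mkcond /=.
apply: eq_bigr => w _; rewrite common_ins e_sym.
by case: (e v w); case: (w \in common y).
Qed.

Lemma ncliques2 : ncliques 2 = arcs setT setT.
Proof.
rewrite ncliquesSS (eq_bigr (fun=> arcs setT setT)) => [|y _].
  exact: sum_clique0.
suff -> : common y = setT by [].
by apply/setP => v; rewrite !inE; apply/forallP => -[].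
Qed.

(** A vertex not adjacent to [x j] can lie only in the term [i = j], so it counts at most once; a
    vertex adjacent to every entry counts [r.+1] times. *)
Lemma sum_common_del r (x : {ffun 'I_r.+1 -> V}) :
  \sum_i #|common (del i x)| <= #|V| + r * #|common x|.
Proof.
have cE (A : {set V}) : #|A| = \sum_v (v \in A).
  by rewrite -sum1_card big_mkcond; apply: eq_bigr => v _; case: (v \in A).
rewrite (eq_bigr _ (fun i _ => cE _)) exchange_big /= cE big_distrr /=.
rewrite -sum1_card -big_split /=; apply: leq_sum => v _.
have [/[!inE]/forallP vx|] := boolP (v \in common x).
  rewrite muln1 add1n -[X in _ <= X]muln1 -[X in _ <= X * _]card_ord -sum_nat_const.
  by apply: leq_sum => i _; case: (_ \in _).
rewrite inE negb_forall => /existsP[j Nvj].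
rewrite (bigD1 j) //= muln0 addn0 big1 ?addn0 ?leq_b1 // => i ij.
apply/eqP; rewrite eqb0 inE negb_forall.
case: (unliftP i j) => [j' jE|jE]; last by rewrite jE eqxx in ij.
by apply/existsP; exists j'; rewrite ffunE -jE.
Qed.

(** Deleting entry [i] groups the cliques by the remaining tuple [y]; each [y] arises [#|common y|]
    times and contributes that number each time. *)
Lemma sum_card_common_del r (i : 'I_r.+1) :
  \sum_(x : {ffun 'I_r.+1 -> V} | clique x) #|common (del i x)| =
  \sum_(y : {ffun 'I_r -> V} | clique y) #|common y| ^ 2.
Proof.
rewrite (sum_clique_ins i); apply: eq_bigr => y _.
by under eq_bigr do rewrite del_ins; rewrite sum_nat_const mulnn.
Qed.

(** Grouping by the remaining tuple [y] again, each [y] arises at most [#|V|] times, and the arcs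
    inside [common y] are the ways to extend [y] by two vertices. *)
Lemma sum_arcs_common_del r (i : 'I_r.+1) :
  \sum_(x : {ffun 'I_r.+1 -> V} | clique x)
     arcs (common (del i x)) (common (del i x)) <= #|V| * ncliques r.+2.
Proof.
rewrite (sum_clique_ins i) ncliquesSS big_distrr /=; apply: leq_sum => y _.
under eq_bigr do rewrite del_ins.
by rewrite sum_nat_const leq_mul2r max_card orbT.
Qed.

End Cliques.

Local Open Scope ring_scope.

Lemma exists_ge_average (R : realFieldType) (I : finType) (P : pred I)
    (f : I -> R) (c : R) :
  (0 < #|P|)%N -> c * #|P|%:R <= \sum_(i | P i) f i -> exists2 i, P i & c <= f i.
Proof.
move=> P0 le_sum; apply/exists_inP; apply: contraLR le_sum.
rewrite negb_exists_in => /forall_inP lt_f; rewrite -ltNge.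
rewrite mulr_natr -sumr_const; have [i0 Pi0] := card_gt0P P0.
rewrite [ltRHS](bigD1 i0) // [ltLHS](bigD1 i0) //=.
apply: ltr_leD; first by rewrite ltNge lt_f.
by apply: ler_sum => i /andP[Pi _]; rewrite ltW // ltNge lt_f.
Qed.

(** * Moon-Moser inequalities and stability *)

Section Stability.
Variables (R : realFieldType) (V : finType) (e : rel V).
Hypothesis e_sym : symmetric e.
Local Notation m := (#|V|%:R : R).
Local Notation N r := ((ncliques e r)%:R : R).

(** Expanding the nonnegative sum of the squares of [#|common e y| - a] gives at least
    [2 * a * N r.+1 - a ^+ 2 * N r], and the hypothesis on [a] absorbs the last term. This is
    Cauchy-Schwarz without a division by [N r]. *)
Lemma sum_common_sqr_ge r (a : R) : 0 <= a -> a * N r <= N r.+1 ->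
  a * N r.+1 <= \sum_(y : {ffun 'I_r -> V} | clique e y) #|common e y|%:R ^+ 2.
Proof.
move=> a0 le_a.
have sq0 : 0 <= \sum_(y : {ffun 'I_r -> V} | clique e y) (#|common e y|%:R - a) ^+ 2.
  by apply: sumr_ge0 => y _; exact: sqr_ge0.
have sqE : \sum_(y : {ffun 'I_r -> V} | clique e y) (#|common e y|%:R - a) ^+ 2 =
    \sum_(y : {ffun 'I_r -> V} | clique e y) #|common e y|%:R ^+ 2
      - 2 * a * N r.+1 + a ^+ 2 * N r.
  rewrite ncliquesS // (ncliquesE e r) !natr_sum !mulr_sumr -sumrN -!big_split /=.
  by apply: eq_bigr => y _; ring.
have := ler_wpM2l a0 le_a; lra.
Qed.

(* Moon-Moser: double count the pairs of a clique and a vertex adjacent to all but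
   at most one of its members. *)
Lemma ncliques_succ_ge k (eta : R) : (0 < k)%N ->
  (1 - k%:R^-1 - eta) * m ^+ 2 <= N 2 -> 0 <= eta ->
  forall r, (0 < r)%N -> (1 - r%:R / k%:R - r%:R * eta) * m * N r <= N r.+1.
Proof.
move=> k0 N2 eta0 r; elim: r => // -[|r] IHr _.
  by rewrite ncliques1 //; move: N2; rewrite expr2 !mulrA !mul1r.
have {IHr} := IHr isT; set a := (1 - _ - _) * m => le_a.
(* The coefficient decreases with [r], so once it is negative the claim is trivial. *)
have [a_lt0|a_ge0] := ltP (1 - r.+1%:R / k%:R - r.+1%:R * eta) 0.
  apply: le_trans (ler0n _ _); rewrite mulr_le0_ge0 // mulr_le0_ge0 //.
  have : (0 : R) <= k%:R^-1 by rewrite invr_ge0.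
  rewrite -!(natr1 r.+1); move: a_lt0; move: k%:R^-1 => u; nra.
have a0 : 0 <= a by rewrite mulr_ge0.
have sq := sum_common_sqr_ge a0 le_a.
have le_del : r.+2%:R * \sum_(y : {ffun 'I_r.+1 -> V} | clique e y)
    (#|common e y|%:R : R) ^+ 2 <= m * N r.+2 + r.+1%:R * N r.+3.
  rewrite -!natrM -!natrD.
  under eq_bigr do rewrite -natrX.
  rewrite -natr_sum -natrM ler_nat.
  rewrite -[X in (X * _)%N]card_ord -sum_nat_const.
  rewrite -(eq_bigr _ (fun i _ => sum_card_common_del e_sym i)) exchange_big /=.
  rewrite (ncliquesS e_sym r.+2) ncliquesE !big_distrr -big_split /=.
  by apply: leq_sum => x _; rewrite muln1; exact: sum_common_del.
have r0 : (0 : R) < r.+1%:R by rewrite ltr0n.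
rewrite -(ler_pM2l r0).
have kn0 : k%:R != 0 :> R by rewrite pnatr_eq0 -lt0n.
(* The coefficients are linear in [r] because they solve the recursion that the double count
   produces. *)
have -> : r.+1%:R * ((1 - r.+2%:R / k%:R - r.+2%:R * eta) * m * N r.+2) =
          (r.+2%:R * a - m) * N r.+2.
  by rewrite /a -!(natr1 r.+1); field.
have r20 : (0 : R) <= r.+2%:R by rewrite ler0n.
have := ler_wpM2l r20 sq; lra.
Qed.

(** The ratios of consecutive clique counts are multiplied up: below [k] each is at least
    [m / (2 * k)], since [1 - r / k >= 1 / k] and [r * eta <= 1 / (2 * k)]. *)
Lemma ncliques_ge k (eta : R) : (0 < k)%N ->
  (1 - k%:R^-1 - eta) * m ^+ 2 <= N 2 -> 0 <= eta -> k%:R ^+ 2 * eta <= 1 / 2 ->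
  forall r, (r <= k)%N -> m ^+ r <= (2 * k%:R) ^+ r * N r.
Proof.
move=> k0 N2 eta0 eta_small; elim=> [|[|r] IHr] rk.
- by rewrite ncliques0 !expr0 mul1r.
- rewrite ncliques1 // !expr1 ler_peMl //.
  have : (1 : R) <= k%:R by rewrite ler1n.
  lra.
have := ncliques_succ_ge k0 N2 eta0 (ltn0Sn r).
have {IHr} := IHr (ltnW rk); rewrite [m ^+ r.+2]exprS [_ ^+ r.+2]exprS.
set b := (2 * _) ^+ _; set q := 1 - _ - _ => IHr le_q.
have kp : (0 : R) < k%:R by rewrite ltr0n.
have q_ge : 1 <= 2 * k%:R * q.
  have -> : 2 * k%:R * q = 2 * (k%:R - r.+1%:R) - 2 * k%:R * r.+1%:R * eta.
    by rewrite /q; field; rewrite gt_eqF.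
  have : r.+1%:R + 1 <= k%:R :> R by rewrite natr1 ler_nat.
  have : (0 : R) <= r.+1%:R by [].
  move: (r.+1%:R : R) => x x0 xk.
  have : k%:R * x * eta <= k%:R ^+ 2 * eta.
    by rewrite ler_wpM2r // expr2 ler_pM2l //; lra.
  lra.
have b0 : 0 <= b by rewrite exprn_ge0 // mulr_ge0.
have m0 : (0 : R) <= m by [].
have N0 : 0 <= N r.+1 by [].
apply: le_trans (_ : m * (b * N r.+1) <= _); first by rewrite ler_wpM2l.
apply: le_trans (_ : (2 * k%:R * b) * (q * m * N r.+1) <= _); last first.
  by rewrite ler_wpM2l // mulr_ge0 // mulr_ge0.
have -> : 2 * k%:R * b * (q * m * N r.+1) = (2 * k%:R * q) * (m * (b * N r.+1)) by ring.
by rewrite ler_peMl // !mulr_ge0.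
Qed.

(** The clique is found by averaging [Phi]. Moon-Moser bounds the covering term from below at a
    relative loss of [k.+1 ^ 2 * eta]; each of the two penalties is at most [k.+1 * m * N k.+2],
    small against [m ^+ 2 * N k.+1] by [ncliques_ge]. Hence the two summands of [w]. *)
Lemma exists_dominating_clique k (eta tau : R) :
  let w := k.+1%:R ^+ 2 * eta + 2 * k.+1%:R * tau * (2 * k.+1%:R) ^+ k.+1 in
  (0 < k)%N -> (0 < #|V|)%N -> 0 <= tau ->
  (1 - k.+1%:R^-1 - eta) * m ^+ 2 <= N 2 -> 0 <= eta -> k.+1%:R ^+ 2 * eta <= 1 / 2 ->
  N k.+2 <= tau * m ^+ k.+2 ->
  exists x : {ffun 'I_k.+1 -> V},
    m * #|common e x|%:R
      + \sum_i (arcs e (common e (del i x)) (common e (del i x)))%:R <= w * m ^+ 2 /\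
    (1 - w) * m <= \sum_i #|common e (del i x)|%:R.
Proof.
move=> w k0 V0 tau0 N2 eta0 eta_small Nfew.
have m0 : 0 < m by rewrite ltr0n.
have K0 : (0 : R) < k.+1%:R by rewrite ltr0n.
have Nge := ncliques_ge (ltn0Sn k) N2 eta0 eta_small (leqnn _).
have NK0 : 0 < N k.+1.
  have : 0 < m ^+ k.+1 by rewrite exprn_gt0.
  move=> /lt_le_trans -/(_ _ Nge); rewrite pmulr_rgt0 // exprn_gt0 //; lra.
(* The overlap has weight [k.+1] where [sum_common_del] costs only [k], so a large [Phi] also bounds
   the overlap itself. *)
pose Phi (x : {ffun 'I_k.+1 -> V}) : R :=
  m * \sum_i #|common e (del i x)|%:R - k.+1%:R * m * #|common e x|%:R
  - \sum_i (arcs e (common e (del i x)) (common e (del i x)))%:R.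
have cK : #|[pred x : {ffun 'I_k.+1 -> V} | clique e x]| = ncliques e k.+1.
  by rewrite /ncliques cardsE.
have [] := @exists_ge_average R _ [pred x : {ffun 'I_k.+1 -> V} | clique e x] Phi
    ((1 - w) * m ^+ 2); rewrite ?cK; first by move: NK0; rewrite ltr0n.
  have S1 : (1 - k.+1%:R ^+ 2 * eta) * m * N k.+1 <=
      \sum_(x : {ffun 'I_k.+1 -> V} | clique e x) \sum_i (#|common e (del i x)|%:R : R).
    rewrite exchange_big /=.
    under eq_bigr => i _ do rewrite -natr_sum (sum_card_common_del e_sym) natr_sum.
    rewrite sumr_const card_ord.
    under eq_bigr => y _ do rewrite natrX.
    have := ncliques_succ_ge (ltn0Sn k) N2 eta0 k0.
    set a := (1 - _ - _) * m => le_a.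
    have a0 : 0 <= a.
      rewrite mulr_ge0 //; move: eta_small; rewrite -!(natr1 k).
      have : (1 : R) <= k%:R by rewrite ler1n.
      have k1n0: k%:R + 1 != 0 :> R by rewrite natr1 gt_eqF.
      have -> : 1 - k%:R / (k%:R + 1) = (k%:R + 1)^-1 :> R by field.
      move=> k1 h; rewrite -(ler_pM2l (_ : 0 < k%:R + 1)) ?natr1 // -natr1.
      rewrite mulrBr divff // mulr0.
      have : 0 <= k%:R * eta by rewrite mulr_ge0.
      lra.
    have := sum_common_sqr_ge a0 le_a.
    move=> sq; rewrite -[leRHS]mulr_natl.
    apply: le_trans (ler_wpM2l (ltW K0) sq).
    rewrite mulrA ler_pM2r // /a mulrA ler_pM2r //.
    have -> : k.+1%:R * (1 - k%:R / k.+1%:R - k%:R * eta) =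
       1 - k.+1%:R * k%:R * eta by rewrite -natr1; field; rewrite natr1 gt_eqF.
    rewrite lerD2l lerN2 ler_wpM2r // expr2 ler_pM2l //; rewrite ler_nat //.
  have S2 : \sum_(x : {ffun 'I_k.+1 -> V} | clique e x) (#|common e x|%:R : R) = N k.+2.
    by rewrite ncliquesS // natr_sum.
  have S3 : \sum_(x : {ffun 'I_k.+1 -> V} | clique e x)
      \sum_i ((arcs e (common e (del i x)) (common e (del i x)))%:R : R)
      <= k.+1%:R * m * N k.+2.
    rewrite exchange_big /= -mulrA -natrM mulr_natl.
    rewrite -[X in _ *+ X](card_ord k.+1) -sumr_const.
    apply: ler_sum => i _; rewrite -natr_sum ler_nat.
    exact: sum_arcs_common_del.
  have PhiE : \sum_(x : {ffun 'I_k.+1 -> V} | clique e x) Phi x =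
      m * (\sum_(x : {ffun 'I_k.+1 -> V} | clique e x) \sum_i (#|common e (del i x)|%:R : R))
      - k.+1%:R * m * N k.+2 -
      \sum_(x : {ffun 'I_k.+1 -> V} | clique e x)
      \sum_i ((arcs e (common e (del i x)) (common e (del i x)))%:R : R).
    by rewrite /Phi big_split sumrN /= big_split sumrN /= -S2 !mulr_sumr.
  rewrite PhiE.
  have := ler_wpM2l (ltW m0) S1.
  have : k.+1%:R * m * N k.+2 <=
      k.+1%:R * tau * (2 * k.+1%:R) ^+ k.+1 * m ^+ 2 * N k.+1.
    apply: le_trans (_ : k.+1%:R * m * (tau * m ^+ k.+2) <= _).
      by rewrite ler_wpM2l // mulr_ge0.
    rewrite [m ^+ k.+2]exprS.
    have -> : k.+1%:R * m * (tau * (m * m ^+ k.+1)) =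
       (k.+1%:R * tau * m ^+ 2) * m ^+ k.+1 by ring.
    have -> : k.+1%:R * tau * (2 * k.+1%:R) ^+ k.+1 * m ^+ 2 * N k.+1 =
       (k.+1%:R * tau * m ^+ 2) * ((2 * k.+1%:R) ^+ k.+1 * N k.+1) by ring.
    by rewrite ler_wpM2l // !mulr_ge0 // exprn_ge0.
  rewrite /w; move: ((2 * _) ^+ _) => u; lra.
move=> x _; rewrite /Phi => le_Phi; exists x.
have del_le : \sum_i #|common e (del i x)|%:R <= m + k%:R * #|common e x|%:R :> R.
  by rewrite -natrM -natrD -natr_sum ler_nat sum_common_del.
have arcs0 : 0 <= \sum_i ((arcs e (common e (del i x)) (common e (del i x)))%:R : R).
  exact: sumr_ge0.
have c0 : 0 <= #|common e x|%:R :> R by [].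
move: le_Phi del_le; rewrite -natr1; set s := \sum_i _; set A := \sum_i _ in arcs0 *.
move: (#|common e x|%:R : R) c0 => c c0 le_Phi del_le; split.
  have := ler_wpM2l (ltW m0) del_le; lra.
rewrite -(ler_pM2l m0).
have : 0 <= (k%:R + 1) * m * c by rewrite mulr_ge0 // mulr_ge0 // natr1.
lra.
Qed.

End Stability.

(** * Arc counts between vertex sets *)

Section Arcs.
Variables (V : finType) (e : rel V).

Lemma arcs_subset (A B C D : {set V}) :
  A \subset C -> B \subset D -> (arcs e A B <= arcs e C D)%N.
Proof.
move=> sAC sBD; rewrite /arcs [leqRHS](big_setID A) (setIidPr sAC) /=.
apply: leq_trans (leq_addr _ _); apply: leq_sum => a _.
by rewrite [leqRHS](big_setID B) (setIidPr sBD) /= leq_addr.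
Qed.

Lemma arcs_le_cards (A B : {set V}) : (arcs e A B <= #|A| * #|B|)%N.
Proof.
rewrite -sum_nat_const; apply: leq_sum => a _.
by rewrite -sum1_card; apply: leq_sum => b _; case: (e a b).
Qed.

Lemma arcs_bigcup (I : finType) (Q : I -> {set V}) :
  (forall i j, i != j -> [disjoint Q i & Q j]) ->
  arcs e (\bigcup_i Q i) (\bigcup_i Q i) = (\sum_i \sum_j arcs e (Q i) (Q j))%N.
Proof.
move=> Qdis; rewrite /arcs partition_disjoint_bigcup //.
apply: eq_bigr => i _; rewrite [RHS]exchange_big /=.
by apply: eq_bigr => a _; rewrite partition_disjoint_bigcup.
Qed.

Lemma arcs_setT_le (C : {set V}) :
  (arcs e setT setT <= arcs e C C + 2 * (#|~: C| * #|V|))%N.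
Proof.
rewrite /arcs [leqLHS](big_setID C) setTI setTD /= mul2n -addnn addnA.
apply: leq_add; last first.
  by apply: leq_trans (arcs_le_cards _ _) _; rewrite cardsT.
rewrite (eq_bigr (fun a => \sum_(b in C) e a b + \sum_(b in ~: C) e a b)%N).
  rewrite big_split leq_add2l /= mulnC.
  apply: leq_trans (arcs_le_cards _ _) _.
  by rewrite leq_mul2r max_card orbT.
by move=> a _; rewrite (big_setID C) setTI setTD.
Qed.

End Arcs.

(** * Graphs close to a complete balanced multipartite graph *)

Section NearTuran.
Variables (R : realFieldType) (V : finType) (e : rel V).
Hypothesis e_sym : symmetric e.
Local Notation m := (#|V|%:R : R).

(** The missing arcs between classes and the squared deviations of the class sizes from [m / k.+1]
    together amount to at most [beta ^+ 2 * m ^+ 2]. Both are sums of nonnegative terms, so every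
    single term obeys this bound. *)
Lemma near_turan_partition k (eta tau beta : R) :
  let w := k.+1%:R ^+ 2 * eta + 2 * k.+1%:R * tau * (2 * k.+1%:R) ^+ k.+1 in
  (0 < k)%N -> (0 < #|V|)%N -> 0 <= tau -> 0 <= eta ->
  k.+1%:R ^+ 2 * eta <= 1 / 2 -> 0 <= beta ->
  eta + (2 * k.+1%:R + 6) * w <= beta ^+ 2 ->
  (1 - k.+1%:R^-1 - eta) * m ^+ 2 <= (arcs e setT setT)%:R ->
  (ncliques e k.+2)%:R <= tau * m ^+ k.+2 ->
  exists Q : 'I_k.+1 -> {set V},
    [/\ forall i j, i != j -> [disjoint Q i & Q j],
        forall i, (k.+1%:R^-1 - beta) * m <= #|Q i|%:R &
        forall i j, i != j ->
          (#|Q i| * #|Q j|)%:R - beta ^+ 2 * m ^+ 2 <= (arcs e (Q i) (Q j))%:R].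
Proof.
move=> w k0 V0 tau0 eta0 eta_small beta0 wbeta N2 Nfew.
have m0 : 0 < m by rewrite ltr0n.
have K0 : (0 : R) < k.+1%:R by rewrite ltr0n.
have K2 : (2 : R) <= k.+1%:R by rewrite ler_nat ltnS.
have w0 : 0 <= w.
  by rewrite addr_ge0 // !mulr_ge0 // ?exprn_ge0 ?mulr_ge0.
rewrite -ncliques2 // in N2.
have [x [x_few x_cov]] :=
  exists_dominating_clique e_sym k0 V0 tau0 N2 eta0 eta_small Nfew.
rewrite -/w in x_few x_cov.
(* Removing the common part makes the classes disjoint: a vertex in two of the neighbourhoods is
   adjacent to every entry of [x]. *)
pose Q i := common e (del i x) :\: common e x; exists Q.
have Qdis i j : i != j -> [disjoint Q i & Q j].
  move=> ij; apply/pred0P => v /=; apply/negP.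
  rewrite !inE => /andP[/andP[/negP nvx /forallP vi] /andP[_ /forallP vj]].
  apply: nvx; apply/forallP => l.
  case: (unliftP i l) => [l' ->|->]; first by have := vi l'; rewrite ffunE.
  case: (unliftP j i) => [l' ->|ij']; first by have := vj l'; rewrite ffunE.
  by rewrite ij' eqxx in ij.
have sub_del i : common e x \subset common e (del i x).
  apply/subsetP => v; rewrite !inE => /forallP vx; apply/forallP => j.
  by rewrite ffunE.
pose q i : R := #|Q i|%:R; pose s := \sum_i q i.
pose a i j : R := (arcs e (Q i) (Q j))%:R.
have common_le : #|common e x|%:R <= w * m.
  rewrite -(ler_pM2l m0); apply: le_trans (_ : w * m ^+ 2 <= _); last by lra.
  by apply: le_trans x_few; rewrite lerDl sumr_ge0.
have qE i : q i = #|common e (del i x)|%:R - #|common e x|%:R.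
  by rewrite /q /Q cardsD (setIidPr (sub_del i)) natrB // subset_leq_card.
have s_ge : (1 - (k.+1%:R + 1) * w) * m <= s.
  rewrite /s (eq_bigr _ (fun i _ => qE i)) big_split sumrN /= sumr_const card_ord.
  rewrite -[X in _ <= _ - X]mulr_natl.
  have := ler_wpM2l (ltW K0) common_le; lra.
have cardU : #|\bigcup_i Q i|%:R = s.
  rewrite -sum1_card partition_disjoint_bigcup //= natr_sum.
  by apply: eq_bigr => i _; rewrite sum1_card.
have s_le : s <= m by rewrite -cardU ler_nat max_card.
have diag : \sum_i a i i <= w * m ^+ 2.
  apply: le_trans x_few; rewrite -[leLHS]add0r lerD ?mulr_ge0 //.
  by apply: ler_sum => i _; rewrite ler_nat arcs_subset ?subsetDl.
have total : (1 - k.+1%:R^-1 - eta) * m ^+ 2 - 2 * (m - s) * m <= \sum_i \sum_j a i j.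
  move: N2; rewrite ncliques2 // => /le_trans.
  move=> /(_ (arcs e (\bigcup_i Q i) (\bigcup_i Q i)
     + 2 * (#|~: \bigcup_i Q i| * #|V|))%:R).
  rewrite ler_nat arcs_setT_le => /(_ isT).
  rewrite arcs_bigcup // natrD !natrM cardsCs setCK natrB ?max_card // cardU.
  rewrite natr_sum (eq_bigr (fun i => \sum_j a i j)); first by rewrite lerBlDr mulrA.
  by move=> i _; rewrite natr_sum.
have a_le i j : a i j <= q i * q j by rewrite -natrM ler_nat arcs_le_cards.
have sqE : \sum_i (q i - m / k.+1%:R) ^+ 2 =
    \sum_i q i ^+ 2 - 2 * (m / k.+1%:R) * s + m ^+ 2 / k.+1%:R.
  rewrite (eq_bigr (fun i => q i ^+ 2 - 2 * (m / k.+1%:R) * q i + (m / k.+1%:R) ^+ 2)).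
    rewrite !big_split sumrN /= -mulr_sumr sumr_const card_ord -[X in _ + X = _]mulr_natl.
    by congr (_ + _); field; rewrite ?nat1r ?natr1 gt_eqF.
  by move=> i _; ring.
have ssE : s ^+ 2 = \sum_i \sum_j q i * q j.
  by rewrite expr2 /s mulr_suml; apply: eq_bigr => i _; rewrite mulr_sumr.
pose miss := \sum_i (\sum_j (q i * q j - a i j) - (q i * q i - a i i)).
have missE : miss = s ^+ 2 - \sum_i \sum_j a i j - \sum_i q i ^+ 2 + \sum_i a i i.
  rewrite /miss ssE -!sumrN -!big_split /=; apply: eq_bigr => i _.
  by rewrite !big_split /= ?sumrN; ring.
(* The sum of the [q i ^+ 2] cancels between [missE] and [sqE]. With full coverage and no inner arcs
   the rest is at most [eta * m ^+ 2]; uncovered vertices add [2 * (k.+1 + 1)] and [3], inner arcs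
   [1], times [w * m ^+ 2]. *)
have main : miss + \sum_i (q i - m / k.+1%:R) ^+ 2 <= beta ^+ 2 * m ^+ 2.
  rewrite missE sqE.
  have : s ^+ 2 <= m ^+ 2 by rewrite ler_sqr ?nnegrE // -cardU.
  have : 2 * (m - s) * m <= 2 * ((k.+1%:R + 1) * w * m) * m.
    by rewrite ler_pM2r // ler_pM2l //; lra.
  have : 2 * (m / k.+1%:R) * (m - s) <= 3 * w * m ^+ 2.
    apply: le_trans (_ : 2 * (m / k.+1%:R) * ((k.+1%:R + 1) * w * m) <= _).
      by rewrite ler_pM2l ?mulr_gt0 ?invr_gt0 //; lra.
    have -> : 2 * (m / k.+1%:R) * ((k.+1%:R + 1) * w * m) =
       (2 + 2 / k.+1%:R) * w * m ^+ 2 by field; rewrite ?nat1r ?natr1 gt_eqF.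
    rewrite ler_pM2r ?exprn_gt0 // ler_wpM2r //.
    rewrite (_ : 3 = 2 + 1) ?lerD2l; last by ring.
    by rewrite ler_pdivrMr // mul1r.
  have := ler_wpM2r (ltW (exprn_gt0 2 m0)) wbeta.
  have -> : m ^+ 2 / k.+1%:R = 2 * (m / k.+1%:R) * m - m ^+ 2 / k.+1%:R.
    by field; rewrite ?nat1r ?natr1 gt_eqF.
  by move: diag total; move: (k.+1%:R^-1 : R) => c; lra.
have miss_inner i j : i != j ->
    q i * q j - a i j <= \sum_j (q i * q j - a i j) - (q i * q i - a i i).
  move=> ij; rewrite (bigD1 i) //= [leRHS]addrC addKr.
  rewrite (bigD1 j) ?(eq_sym j) //= lerDl sumr_ge0 // => l _.
  by rewrite subr_ge0.
have miss_term i :  0 <= \sum_j (q i * q j - a i j) - (q i * q i - a i i).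
  by rewrite (bigD1 i) //= [leRHS]addrC addKr sumr_ge0 // => l _; rewrite subr_ge0.
split=> // [i|i j ij].
  have : (q i - m / k.+1%:R) ^+ 2 <= (beta * m) ^+ 2.
    rewrite exprMn; apply: le_trans main; rewrite -[leLHS]add0r lerD //.
      by apply: sumr_ge0.
    by rewrite (bigD1 i) //= lerDl sumr_ge0 // => l _; exact: sqr_ge0.
  move=> sq_le; rewrite leNgt; apply/negP => lt_q.
  have bm0 : 0 <= beta * m by rewrite mulr_ge0.
  have lt_d : beta * m < m / k.+1%:R - q i
    by move: lt_q; rewrite -/(q i); move: (k.+1%:R^-1 : R) => c; lra.
  suff : (beta * m) ^+ 2 < (m / k.+1%:R - q i) ^+ 2 by move: sq_le; move: (k.+1%:R^-1 : R) => c; lra.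
  by rewrite ltr_pXn2r // nnegrE ltW // (le_lt_trans bm0).
rewrite natrM -/(q i) -/(q j) -/(a i j).
suff : q i * q j - a i j <= beta ^+ 2 * m ^+ 2 by lra.
apply: le_trans main; apply: le_trans (miss_inner _ _ ij) _.
apply: le_trans (_ : miss <= _).
  by rewrite /miss [leRHS](bigD1 i) //= lerDl sumr_ge0.
by rewrite lerDl sumr_ge0 // => l _; exact: sqr_ge0.
Qed.

End NearTuran.

(** Convexity of the power; each induction step leaves the square [(h - a) ^+ 2] with a nonnegative
    factor. It serves as Jensen's inequality in the clique count and, at [a = 1], as Bernoulli's. *)
Lemma expr_ge_tangent (R : realFieldType) (a h : R) t : 0 <= a -> 0 <= h ->
  a ^+ t.+1 + t.+1%:R * a ^+ t * (h - a) <= h ^+ t.+1.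
Proof.
move=> a0 h0; elim: t => [|t IHt]; first by rewrite !expr1 expr0; lra.
rewrite [h ^+ _]exprS; apply: le_trans (ler_wpM2l h0 IHt).
rewrite -subr_ge0.
rewrite [X in 0 <= X](_ : _ = t.+1%:R * a ^+ t * (h - a) ^+ 2).
  by rewrite mulr_ge0 ?sqr_ge0 // mulr_ge0 // exprn_ge0.
by rewrite -(natr1 t.+1) !exprS; ring.
Qed.

(** * Few disjoint (k+1)-tuples *)

Section Disjointness.
Variables (n : nat) (V : finType) (f : V -> {set 'I_n}).

(** The vertices form a type [V] mapped to sets by [f]; in the end [V] is the type of members of
    [F]. *)
Definition disj_rel : rel V := fun a b => [disjoint f a & f b].

Lemma disj_rel_sym : symmetric disj_rel.
Proof. by move=> a b; rewrite /disj_rel disjoint_sym. Qed.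

Definition avoiding_cliques r (S : {set 'I_n}) : {set {ffun 'I_r -> V}} :=
  [set x | clique disj_rel x && [forall i, [disjoint f (x i) & S]]].

Definition avoiding_common r (y : {ffun 'I_r -> V}) (S : {set 'I_n}) : {set V} :=
  [set v in common disj_rel y | [disjoint f v & S]].

Definition hull t (z : {ffun 'I_t -> V}) : {set 'I_n} := \bigcup_j f (z j).

Lemma card_avoiding_cliques0 r :
  #|avoiding_cliques r set0| = ncliques disj_rel r.
Proof.
rewrite /ncliques; apply: eq_card => x; rewrite !inE.
rewrite [X in _ && X](_ : _ = true) ?andbT //; apply/forallP => i.
by rewrite -setI_eq0 setI0.
Qed.

Lemma card_avoiding_cliquesS r S :
  #|avoiding_cliques r.+1 S| =
  (\sum_(y in avoiding_cliques r S) #|avoiding_common y S|)%N.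
Proof.
rewrite -sum1_card (sum_ins ord0) [RHS]big_mkcond /=; apply: eq_bigr => y _.
rewrite inE -[RHS]mul1n -[RHS](_ : \sum_(v | [&& clique disj_rel y
   && [forall i, [disjoint f (y i) & S]] & v \in avoiding_common y S]) 1 = _)%N.
  apply: eq_bigl => v; rewrite !inE clique_ins; last exact: disj_rel_sym.
  rewrite [X in _ && X](_ : _ = [disjoint f v & S]
     && [forall i, [disjoint f (y i) & S]]); last first.
    apply/forallP/andP => [H|[Hv /forallP H] j].
      split; first by have := H ord0; rewrite ins_id.
      by apply/forallP => j; have := H (lift ord0 j); rewrite ins_lift.
    by case: (unliftP ord0 j) => [j'|] ->; rewrite ?ins_lift ?ins_id.
  rewrite inE; case: (clique _ _) => //=.
  by case: [forall i, [disjoint f (y i) & S]]; rewrite ?andbT ?andbF.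
rewrite mul1n; case: (_ && _); last by rewrite big_pred0.
by rewrite sum1_card.
Qed.

(** The [t]-th power of a cardinality counts [t]-tuples [z]; fixing [z] first trades one coordinate
    of the clique for a union of [t] members. *)
Lemma sum_expn_avoiding_common r S t :
  (\sum_(y in avoiding_cliques r S) #|avoiding_common y S| ^ t =
   \sum_(z : {ffun 'I_t -> V})
      #|[set y in avoiding_cliques r S
           | [forall j, z j \in avoiding_common y S]]|)%N.
Proof.
rewrite (eq_bigr (fun y => \sum_(z : {ffun 'I_t -> V})
   [forall j, z j \in avoiding_common y S]))%N.
  rewrite exchange_big /=; apply: eq_bigr => z _.
  by rewrite -sum1_card big_mkcond [RHS]big_mkcond; apply: eq_bigr => y _;
    rewrite inE; case: (_ \in _); case: [forall _, _].
move=> y _; rewrite -[X in (_ ^ X)%N](card_ord t) -card_ffun_on -sum1_card big_mkcond.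
apply: eq_bigr => z _.
have -> : (z \in ffun_on (avoiding_common y S)) = [forall j, z j \in avoiding_common y S].
  by apply/ffun_onP/forallP.
by case: [forall _, _].
Qed.

Lemma avoiding_hull_subset r S t (z : {ffun 'I_t -> V}) :
  [set y in avoiding_cliques r S | [forall j, z j \in avoiding_common y S]]
    \subset avoiding_cliques r (S :|: hull z).
Proof.
apply/subsetP => y; rewrite !inE => /andP[/andP[-> /forallP yS] /forallP zH] /=.
apply/forallP => i; rewrite -setI_eq0 setIUr setU_eq0 !setI_eq0 yS /=.
apply: bigcup_disjoint => j _; have := zH j; rewrite !inE => /andP[/forallP /(_ i) + _].
by rewrite /disj_rel disjoint_sym.
Qed.

Lemma hull_disjoint r S t (z : {ffun 'I_t -> V}) y :
  y \in [set y in avoiding_cliques r S | [forall j, z j \in avoiding_common y S]] ->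
  [disjoint S & hull z].
Proof.
rewrite inE => /andP[_ /forallP zH]; apply: bigcup_disjoint => j _.
by have := zH j; rewrite !inE disjoint_sym => /andP[].
Qed.

Hypothesis f_inj : injective f.

(** There are at most [2 ^ n] choices for the union [U], and given [U] every entry of [z] is one of
    at most [2 ^ s] subsets of it. *)
Lemma card_small_hull t s :
  (#|[set z : {ffun 'I_t -> V} | #|hull z| <= s]| <= 2 ^ n * (2 ^ s) ^ t)%N.
Proof.
apply: leq_trans (_ : \sum_(U : {set 'I_n} | #|U| <= s)
    #|[set z : {ffun 'I_t -> V} | hull z == U]| <= _)%N.
  rewrite -sum1_card (partition_big (@hull t) (fun U => #|U| <= s)%N) /=.
    apply: leq_sum => U _; rewrite sum1_card; apply: subset_leq_card.
    by apply/subsetP => z; rewrite !inE unfold_in => /andP[].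
  by move=> z; rewrite inE.
apply: leq_trans (_ : \sum_(U : {set 'I_n} | #|U| <= s) (2 ^ s) ^ t <= _)%N.
  apply: leq_sum => U Us.
  apply: leq_trans (_ : #|ffun_on [set v : V | f v \subset U] : pred {ffun 'I_t -> V}| <= _)%N.
    apply: subset_leq_card; apply/subsetP => z; rewrite inE => /eqP zU.
    by apply/ffun_onP => j; rewrite inE -zU /hull (bigcup_sup j).
  rewrite card_ffun_on card_ord; case: t => // t; rewrite leq_exp2r //.
  apply: leq_trans (_ : 2 ^ #|U| <= _)%N; last by rewrite leq_pexp2l.
  rewrite -card_powerset -(card_imset _ f_inj); apply: subset_leq_card.
  by apply/subsetP => _ /imsetP[v + ->]; rewrite !inE.
rewrite sum_nat_const leq_mul2r; apply/orP; right.
by apply: leq_trans (max_card _) _; rewrite -cardsT -powersetT card_powerset cardsT card_ord.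
Qed.

End Disjointness.

(* The hypothesis on S says that r sets with more than n / (k + 1) elements do not
   fit disjointly outside S; in the induction S absorbs the unions already chosen. *)
Lemma few_avoiding_cliques (R : archiRealFieldType) k r (tau : R) :
  (0 < k)%N -> 0 < tau ->
  exists n0, forall n, (n0 <= n)%N -> forall (V : finType) (f : V -> {set 'I_n}),
    injective f -> (2 ^ n <= #|V| ^ k)%N ->
  forall S : {set 'I_n}, (n < #|S| + r * (n %/ k.+1).+1)%N ->
  #|avoiding_cliques f r S|%:R <= tau * #|V|%:R ^+ r.
Proof.
move=> k0; elim: r tau => [|r IHr] tau tau0.
  exists 0%N => n _ V f f_inj _ S; rewrite mul0n addn0 => /leq_trans.
  by move=> /(_ _ (max_card _)); rewrite card_ord ltnn.
(* For this exponent at most [2 ^ (n + 2 * k * n)] tuples have a hull of size at most [s], while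
   [m ^ t.+1] is at least [2 ^ (2 * k.+1 * n)]; their proportion is thus at most [2 ^ - n]. *)
pose t := (2 * (k * k.+1)).-1.
have tE : t.+1 = (2 * (k * k.+1))%N by rewrite prednK // !muln_gt0 k0.
(* The tuples with a small hull and the induction hypothesis each get half of [tau ^+ t.+1]. *)
have taut0 : 0 < tau ^+ t.+1 / 2 by rewrite divr_gt0 // exprn_gt0.
have [n1 few] := IHr _ taut0.
exists (maxn n1 (Num.bound (tau ^+ t.+1 / 2)^-1)) => n.
rewrite geq_max => /andP[/few {}few le_n] V f f_inj V_large S S_large.
have {few}few := few _ f f_inj V_large.
set m : R := #|V|%:R; set s := (n %/ k.+1)%N in few S_large *.
have m0 : 0 < m.
  rewrite ltr0n; case: (posnP #|V|) => // V0.
  by move: V_large; rewrite V0 exp0n // leqNgt expn_gt0.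
have small_n : (2 ^ n)%:R^-1 <= tau ^+ t.+1 / 2.
  rewrite -[leRHS]invrK lef_pV2 ?posrE ?invr_gt0 //; last by rewrite ltr0n expn_gt0.
  apply: ltW; apply: lt_le_trans (archi_boundP _) _; first by rewrite invr_ge0 ltW.
  by rewrite ler_nat; apply: leq_trans le_n _; rewrite ltnW // ltn_expl.
have small_hulls : #|[set z : {ffun 'I_t.+1 -> V} | #|hull f z| <= s]%N|%:R
    <= (2 ^ n)%:R^-1 * m ^+ t.+1.
  rewrite ler_pdivlMl; last by rewrite ltr0n expn_gt0.
  rewrite -natrX -natrM ler_nat.
  apply: leq_trans (_ : 2 ^ n * (2 ^ n * (2 ^ s) ^ t.+1) <= _)%N.
    by rewrite leq_mul2l card_small_hull ?orbT.
  apply: leq_trans (_ : (2 ^ n) ^ (2 * k.+1) <= _)%N; last first.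
    by rewrite tE mulnCA [leqRHS]expnM leq_exp2r.
  rewrite mulnA -expnD -!expnM -expnD leq_exp2l // tE.
  have : (s * k.+1 <= n)%N by exact: leq_trunc_div.
  nia.
have pow_le : (\sum_(y in avoiding_cliques f r S) #|avoiding_common f y S| ^ t.+1)%N%:R
    <= tau ^+ t.+1 * m ^+ t.+1 * m ^+ r.
  rewrite sum_expn_avoiding_common (bigID (fun z => #|hull f z| <= s)%N) /= natrD.
  apply: le_trans (_ : (2 ^ n)%:R^-1 * m ^+ t.+1 * m ^+ r
     + tau ^+ t.+1 / 2 * m ^+ r * m ^+ t.+1 <= _); last first.
    have : 0 <= m ^+ t.+1 * m ^+ r by rewrite mulr_ge0 // exprn_ge0 // ltW.
    move/ler_wpM2r => /(_ _ _ small_n).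
    move: (m ^+ t.+1) (m ^+ r) (tau ^+ t.+1) ((2 ^ n)%:R^-1) => a b c d; lra.
  apply: lerD.
    apply: le_trans (ler_wpM2r _ small_hulls); last by rewrite exprn_ge0 // ltW.
    rewrite -natrX -natrM ler_nat -[X in (_ <= X * _)%N]sum1dep_card big_distrl /=.
    apply: leq_sum => z _; rewrite mul1n.
    by apply: leq_trans (max_card _) _; rewrite card_ffun card_ord.
  rewrite natr_sum.
  apply: le_trans (_ : \sum_(z : {ffun 'I_t.+1 -> V} | ~~ (#|hull f z| <= s)%N)
     tau ^+ t.+1 / 2 * m ^+ r <= _); last first.
    rewrite sumr_const -[leLHS]mulr_natr ler_wpM2l //.
      by rewrite mulr_ge0 ?exprn_ge0 // ltW.
    rewrite -natrX ler_nat; apply: leq_trans (max_card _) _.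
    by rewrite card_ffun card_ord.
  apply: ler_sum => z; rewrite -ltnNge => z_large.
  set Y := [set y in _ | _].
  (* Any [y] in [Y] certifies that the hull is disjoint from [S], so [S] grows by at least [s.+1]
     elements, which pays for the lost coordinate. *)
  have [->|[y Yy]] := set_0Vmem Y.
    by rewrite cards0 mulr_ge0 ?exprn_ge0 // ltW.
  apply: le_trans (few (S :|: hull f z) _).
    by rewrite ler_nat; apply: subset_leq_card; exact: avoiding_hull_subset.
  have /eqP : #|S :|: hull f z| == (#|S| + #|hull f z|)%N.
    by rewrite (leq_card_setU S (hull f z)).2 (hull_disjoint Yy).
  move=> ->; apply: leq_trans S_large _; rewrite mulSn addnA leq_add2r leq_add2l.
  exact: z_large.
(* If the bound fails, the tangent at [tau * m] pushes the power sum above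
   [(tau * m) ^+ t.+1 * m ^+ r]. The number [c] of tuples [y] enters with a negative sign, so
   [c <= m ^+ r] suffices. *)
rewrite leNgt; apply/negP; rewrite card_avoiding_cliquesS => W_large.
have tau_m0 : 0 < tau * m by rewrite mulr_gt0.
have tangent : \sum_(y in avoiding_cliques f r S)
   ((tau * m) ^+ t.+1 + t.+1%:R * (tau * m) ^+ t * (#|avoiding_common f y S|%:R - tau * m))
   <= tau ^+ t.+1 * m ^+ t.+1 * m ^+ r.
  apply: le_trans pow_le; rewrite natr_sum; apply: ler_sum => y _.
  by rewrite natrX expr_ge_tangent // ltW.
move: tangent; apply/negP; rewrite -ltNge.
rewrite big_split /= sumr_const -mulr_sumr big_split /= sumr_const -natr_sum.
set W : R := (\sum_(y in _) _)%:R in W_large *.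
set c := #|_|.
have c_le : c%:R <= m ^+ r.
  by rewrite -natrX ler_nat; apply: leq_trans (max_card _) _; rewrite card_ffun card_ord.
rewrite -[X in X + _]mulr_natr mulNrn -[X in _ - X]mulr_natr.
rewrite -exprMn [_ ^+ t.+1]exprS.
move: W_large; rewrite [m ^+ r.+1]exprS mulrA.
have b0 : 0 < (tau * m) ^+ t by rewrite exprn_gt0.
move: ((tau * m) ^+ t) b0 => b b0; move: (tau * m) tau_m0 => a a0 W_large.
have : 0 < t.+1%:R * b * (W - a * m ^+ r) by apply: mulr_gt0; [apply: mulr_gt0 | rewrite subr_gt0].
have : 0 <= t%:R * b * a * (m ^+ r - c%:R) by rewrite !mulr_ge0 ?subr_ge0 // ltW.
rewrite -natr1; move: (t%:R : R) (m ^+ r) (c%:R : R) => u v d; nra.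
Qed.

(** * Recovering the cubes *)

Section SparseElements.
Variables (R : realType) (n : nat) (V : finType) (f : V -> {set 'I_n}).
Hypothesis f_inj : injective f.

(** The right side is the product of [w x + 1] over all elements, with [w] equal to 1 on [S], [l] on
    [Z] and 0 elsewhere. Expanded over subsets, it contains the weight of each [f v] once, by
    injectivity. *)
Lemma sum_weight_cube (S Z : {set 'I_n}) (P : {set V}) (l : R) :
  0 <= l -> [disjoint S & Z] -> (forall v, v \in P -> f v \subset S :|: Z) ->
  \sum_(v in P) l ^+ #|f v :&: Z| <= 2 ^+ #|S| * (1 + l) ^+ #|Z|.
Proof.
move=> l0 disSZ Psub.
pose w (x : 'I_n) : R := if x \in S then 1 else if x \in Z then l else 0.
have w0 x : 0 <= w x by rewrite /w; case: ifP => // _; case: ifP.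
have -> : 2 ^+ #|S| * (1 + l) ^+ #|Z| = \prod_x (w x + 1).
  rewrite -!prodr_const [X in X * _ = _]big_mkcond [X in _ * X = _]big_mkcond.
  rewrite -big_split /=; apply: eq_bigr => x _.
  rewrite /w; have [xS|xS] := boolP (x \in S).
    by rewrite (disjointFr disSZ xS); ring.
  by case: ifP => _; ring.
rewrite bigA_distr /=.
pose W (A : {set 'I_n}) : R := \prod_x (if x \in A then w x else 1).
have W0 A : 0 <= W A by apply: prodr_ge0 => x _; case: ifP.
apply: le_trans (_ : \sum_(A in f @: P) W A <= _); last first.
  rewrite [leRHS](bigID (mem (f @: P))) /=.
  by rewrite (eq_bigl (mem (f @: P))) ?lerDl ?sumr_ge0 // => A _; exact: W0.
rewrite big_imset /=; last by move=> ? ? _ _; exact: f_inj.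
apply: ler_sum => v vP; rewrite -prodr_const big_mkcond /W /=.
rewrite le_eqVlt; apply/orP; left; apply/eqP; apply: eq_bigr => x _.
rewrite inE; have [xv|//] := boolP (x \in f v); rewrite /w.
have := subsetP (Psub v vP) x xv; rewrite inE; have [xS|xS /= ->] := boolP (x \in S).
  by rewrite (disjointFr disSZ xS).
by [].
Qed.

(* The weight l ^ b with l = expR (- L) is bounded below by its tangent at the
   mean value of b. *)
Lemma card_sparse_family_le (S Z : {set 'I_n}) (P : {set V}) (L g : R) :
  0 <= L -> [disjoint S & Z] -> (forall v, v \in P -> f v \subset S :|: Z) ->
  (forall x, x \in Z -> #|[set v in P | x \in f v]|%:R <= g * #|P|%:R) ->
  #|P|%:R <= 2 ^+ #|S| * ((1 + expR (- L)) * expR (L * g)) ^+ #|Z|.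
Proof.
move=> L0 disSZ Psub sparse.
have := sum_weight_cube (expR_ge0 (- L)) disSZ Psub.
have sum_deg : \sum_(v in P) #|f v :&: Z|%:R <= #|Z|%:R * (g * #|P|%:R) :> R.
  rewrite mulr_natl -sumr_const.
  apply: le_trans (ler_sum _ _); last by move=> x; exact: sparse.
  rewrite -!natr_sum ler_nat.
  rewrite (eq_bigr (fun v => \sum_(x in Z) (x \in f v))%N); last first.
    by move=> v _; rewrite -sum1_card big_mkcond [RHS]big_mkcond; apply: eq_bigr => x _;
      rewrite inE; case: (x \in f v); case: (x \in Z).
  rewrite exchange_big /=; apply: leq_sum => x _.
  by rewrite -sum1_card big_mkcond [leqRHS]big_mkcond; apply: leq_sum => v _;
    rewrite inE; case: (v \in P); case: (x \in f v).
have tangent : expR (- L * (g * #|Z|%:R)) * #|P|%:R <=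
    \sum_(v in P) expR (- L) ^+ #|f v :&: Z|.
  apply: le_trans (_ : \sum_(v in P) expR (- L * (g * #|Z|%:R)) *
     (1 + L * (g * #|Z|%:R - #|f v :&: Z|%:R)) <= _); last first.
    apply: ler_sum => v _; rewrite -expRM_natl.
    have -> : #|f v :&: Z|%:R * - L = - L * (g * #|Z|%:R) +
      L * (g * #|Z|%:R - #|f v :&: Z|%:R) by ring.
    by rewrite expRD ler_pM2l ?expR_gt0 // expR_ge1Dx.
  rewrite -mulr_sumr ler_pM2l ?expR_gt0 // big_split /= sumr_const lerDl -mulr_sumr.
  rewrite mulr_ge0 // big_split /= sumrN sumr_const -[X in X - _]mulr_natl; lra.
move=> /(le_trans tangent).
have -> : - L * (g * #|Z|%:R) = - (#|Z|%:R * (L * g)) by ring.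
rewrite expRN expRM_natl ler_pdivrMl ?exprn_gt0 ?expR_gt0 //.
by rewrite exprMn; move: (_ ^+ _) (_ ^+ _) (_ ^+ _) => a b c; lra.
Qed.

End SparseElements.

(** The base in the bound on a class, for [L = 6 * k] and [g = (36 * k ^+ 2)^-1]. Both [expR (- L)]
    and [L * g] are at most [(6 * k)^-1], so the power is at most [expR (1 / 3)]. *)
Lemma expR_constant (R : realType) k : (0 < k)%N ->
  ((1 + expR (- (6 * k%:R))) * expR (6 * k%:R * (36 * k%:R ^+ 2)^-1)) ^+ k <= 3 / 2 :> R.
Proof.
move=> k0; have kp : 0 < k%:R :> R by rewrite ltr0n.
apply: le_trans (_ : expR (1 / 3) <= _).
  apply: le_trans (_ : (expR (expR (- (6 * k%:R))) * expR (6 * k%:R * (36 * k%:R ^+ 2)^-1)) ^+ k <= _).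
    rewrite ler_pXn2r ?nnegrE ?mulr_ge0 ?addr_ge0 ?expR_ge0 //.
    by rewrite ler_pM2r ?expR_gt0 // expR_ge1Dx.
  rewrite -expRD -expRM_natl ler_expR.
  have -> : 6 * k%:R * (36 * k%:R ^+ 2)^-1 = (6 * k%:R)^-1 :> R by field; rewrite gt_eqF.
  have le_inv : expR (- (6 * k%:R)) <= (6 * k%:R)^-1 :> R.
    rewrite expRN lef_pV2 ?posrE ?expR_gt0 ?mulr_gt0 //.
    by apply: le_trans (expR_ge1Dx _); rewrite lerDr.
  apply: le_trans (_ : k%:R * ((6 * k%:R)^-1 + (6 * k%:R)^-1) <= _).
    by rewrite ler_pM2l // lerD2r.
  by rewrite le_eqVlt; apply/orP; left; apply/eqP; field; rewrite gt_eqF.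
rewrite -[1 / 3]opprK expRN -[3 / 2]invrK lef_pV2 ?posrE ?expR_gt0 ?invr_gt0 ?divr_gt0 //.
apply: le_trans (expR_ge1Dx _); lra.
Qed.

(** * From the classes to a partition of the ground set *)

Section Cubes.
Variables (R : realType) (n : nat) (V : finType) (f : V -> {set 'I_n}).
Hypothesis f_inj : injective f.
Local Notation m := (#|V|%:R : R).
Local Notation e := (disj_rel f).

Definition popular (b : R) (A : {set V}) : {set 'I_n} :=
  [set x | b * m < #|[set v in A | x \in f v]|%:R].

(** Each such [v] contains an element of more than [b * m] members of [B], so it has that many
    non-neighbours in [B]; at most [b ^+ 2 * m ^+ 2] arcs are missing in all. *)
Lemma card_meeting_popular_le (b : R) (A B : {set V}) : 0 < b -> (0 < #|V|)%N ->
  (#|A| * #|B|)%:R - b ^+ 2 * m ^+ 2 <= (arcs e A B)%:R ->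
  #|[set v in A | ~~ [disjoint f v & popular b B]]|%:R <= b * m.
Proof.
move=> b0 V0 dense; have m0 : 0 < m by rewrite ltr0n.
have bm0 : 0 < b * m by rewrite mulr_gt0.
pose D : {set V} := [set v in A | ~~ [disjoint f v & popular b B]].
rewrite -/D -(ler_pM2r bm0) -expr2 exprMn.
have non_arcs : (arcs e A B + \sum_(a in A) \sum_(c in B) ~~ e a c = #|A| * #|B|)%N.
  rewrite /arcs -big_split /= -sum_nat_const; apply: eq_bigr => a _.
  rewrite -big_split /= -sum1_card; apply: eq_bigr => c _.
  by case: (e a c).
apply: le_trans (_ : (\sum_(a in A) \sum_(c in B) ~~ e a c)%:R <= _); last first.
  by move: dense; rewrite -non_arcs natrD; lra.
have DA : D \subset A by apply/subsetP => v; rewrite inE => /andP[].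
rewrite natr_sum (big_setID D) /= (setIidPr DA) -[leLHS]addr0 lerD ?sumr_ge0 //.
rewrite mulr_natl -sumr_const; apply: ler_sum => v.
rewrite inE => /andP[vA /pred0Pn[x /= /andP[xv]]].
rewrite inE => /ltW/le_trans; apply; rewrite ler_nat -sum1_card big_mkcond.
rewrite [leqRHS]big_mkcond; apply: leq_sum => c _; rewrite inE.
case: (c \in B) => //=; case: ifP => // xc; rewrite lt0b.
by apply/negP => /pred0P /(_ x) /=; rewrite xv xc.
Qed.

(** [x] is 2 to the power [n / k.+1]. The constants keep the [k.+1]-st power of the lower bound on a
    class at [7 / 8 * 2 ^+ n] or more, precise enough to detect one leftover element or a deficit of
    one in a size. *)
Lemma exists_cube_partition k (b eta x : R) (Q : 'I_k.+1 -> {set V}) :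
  0 < b -> b <= (72 * k.+1%:R ^+ 3)^-1 -> eta <= (16 * k.+1%:R)^-1 ->
  0 < x -> x ^+ k.+1 = 2 ^+ n -> (1 - eta) * k.+1%:R * x <= m ->
  (forall i j, i != j -> [disjoint Q i & Q j]) ->
  (forall i, (k.+1%:R^-1 - b) * m <= #|Q i|%:R) ->
  (forall i j, i != j ->
     (#|Q i| * #|Q j|)%:R - b ^+ 2 * m ^+ 2 <= (arcs e (Q i) (Q j))%:R) ->
  exists S : 'I_k.+1 -> {set 'I_n},
    [/\ forall i j, i != j -> [disjoint S i & S j],
        \bigcup_i S i = setT,
        forall i, (k.+1 * #|S i|)%N = n &
        #|[set v | ~~ [exists i, f v \subset S i]]|%:R <= k.+1%:R ^+ 2 * b * m].
Proof.
move=> b0 b_small eta_small x0 xE m_large Qdis Qlarge Qdense.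
set K : R := k.+1%:R in b_small eta_small m_large Qlarge *.
have KE : K = k.+1%:R by [].
clearbody K.
have K1 : 1 <= K by rewrite KE ler1n.
have K0 : 0 < K by rewrite KE ltr0n.
have Kn0 : K != 0 by rewrite gt_eqF.
have K2b : K ^+ 2 * b <= (72 * K)^-1.
  have -> : (72 * K)^-1 = K ^+ 2 * (72 * K ^+ 3)^-1 by field.
  by rewrite ler_pM2l // exprn_gt0.
have Kinv : K^-1 <= 1 by rewrite invf_le1.
have m0 : 0 < m.
  apply: lt_le_trans m_large; rewrite !mulr_gt0 // subr_gt0.
  apply: le_lt_trans eta_small _; rewrite invfM; move: Kinv; lra.
have V0 : (0 < #|V|)%N by rewrite -(ltr0n R).
pose S i := popular b (Q i).
pose bad i j : {set V} := [set v in Q i | ~~ [disjoint f v & S j]].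
have bad_le i j : i != j -> #|bad i j|%:R <= b * m.
  by move=> ij; apply: card_meeting_popular_le => //; exact: Qdense.
(* An element popular in both classes would lie in more than [b * m] members of [Q i], all of which
   meet [S j]. *)
have Sdis i j : i != j -> [disjoint S i & S j].
  move=> ij; apply/pred0P => y /=; apply/negP => /andP[yi yj].
  move: (yi); rewrite inE; apply/negP; rewrite -leNgt.
  apply: le_trans (bad_le _ _ ij); rewrite ler_nat; apply: subset_leq_card.
  apply/subsetP => v; rewrite !inE => /andP[-> yv] /=.
  by apply/pred0Pn; exists y; rewrite /= yv yj.
pose P i := Q i :\: \bigcup_(j | j != i) bad i j.
have Plarge i : (K^-1 - K * b) * m <= #|P i|%:R.
  have : #|Q i|%:R <= #|P i|%:R + k%:R * (b * m).
    rewrite -(cardsID (\bigcup_(j | j != i) bad i j) (Q i)) -/(P i) natrD addrC lerD2l.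
    apply: le_trans (_ : \sum_(j | j != i) #|bad i j|%:R <= _).
      rewrite -natr_sum ler_nat; apply: leq_trans (subset_leq_card (subsetIr _ _)) _.
      apply: (big_ind2 (fun (A : {set V}) c => #|A| <= c)%N); rewrite ?cards0 //.
      by move=> A a B c Aa Bc; rewrite (leq_trans (leq_card_setU A B)) // leq_add.
    apply: le_trans (ler_sum _ _) _; first by move=> j ji; apply: bad_le; rewrite eq_sym.
    by rewrite sumr_const cardC1 card_ord mulr_natl.
  have := Qlarge i; have : K * b * m = k%:R * (b * m) + b * m.
    by rewrite KE -natr1; ring.
  by move: (K^-1) => c; lra.
pose Z := ~: \bigcup_i S i.
have SZ i : [disjoint S i & Z].
  by rewrite disjoint_sym disjoints_subset setCS (bigcup_sup i).
have Psub i v : v \in P i -> f v \subset S i :|: Z.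
  rewrite inE => /andP[vnb vQ]; apply/subsetP => y yv; rewrite inE.
  have [//|yS /=] := boolP (y \in S i); rewrite inE; apply/bigcupP => -[j _ yj].
  have ji : j != i by apply: contraNneq yS => <-.
  move/negP: vnb; apply; apply/bigcupP; exists j => //.
  by rewrite inE vQ; apply/pred0Pn; exists y; rewrite /= yv.
(* An element of [Z] lies in at most [b * m] members of [Q i], and [P i] keeps at least
   [m / (2 * K)] members; hence the 72 in [b_small], twice 36. *)
have Psparse i y : y \in Z ->
    #|[set v in P i | y \in f v]|%:R <= (36 * K ^+ 2)^-1 * #|P i|%:R.
  move=> yZ; apply: le_trans (_ : b * m <= _).
    apply: le_trans (_ : #|[set v in Q i | y \in f v]|%:R <= _).
      rewrite ler_nat; apply: subset_leq_card; apply/subsetP => v.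
      by rewrite !inE => /andP[/andP[_ ->] ->].
    rewrite leNgt; move: yZ; rewrite inE; apply: contra => yS.
    by apply/bigcupP; exists i => //; rewrite inE.
  have g0 : 0 < (36 * K ^+ 2)^-1 by rewrite invr_gt0 mulr_gt0 // exprn_gt0.
  apply: le_trans (ler_wpM2l (ltW g0) (Plarge i)).
  rewrite mulrA ler_pM2r //; apply: le_trans b_small _.
  have -> : (72 * K ^+ 3)^-1 = (36 * K ^+ 2)^-1 * (2 * K)^-1 by field.
  rewrite ler_pM2l //.
  have -> : K * b = (K ^+ 2 * b) * K^-1 by field.
  have : (K ^+ 2 * b) * K^-1 <= 72^-1 * K^-1.
    rewrite ler_pM2r ?invr_gt0 //; apply: le_trans K2b _.
    by rewrite invfM -[leRHS]mulr1 ler_pM2l // invr_gt0.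
  have : 0 < K^-1 by rewrite invr_gt0.
  by rewrite invfM; move: (K^-1) => c; lra.
pose h : R := (1 + expR (- (6 * K))) * expR (6 * K * (36 * K ^+ 2)^-1).
have Pup i : #|P i|%:R <= 2 ^+ #|S i| * h ^+ #|Z|.
  apply: (card_sparse_family_le f_inj _ (SZ i) (@Psub i) (@Psparse i)).
  by rewrite mulr_ge0 // ltW.
(* The losses [eta <= 1 / (16 * K)] and [K ^+ 2 * b <= 1 / (72 * K)] together stay below
   [1 / (8 * K)]. *)
have Plow i : (1 - (8 * K)^-1) * x <= #|P i|%:R.
  apply: le_trans (Plarge i).
  have : (K^-1 - K * b) * ((1 - eta) * K * x) <= (K^-1 - K * b) * m.
    rewrite ler_pM2l // subr_gt0 -(ltr_pM2l K0) divff //.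
    rewrite mulrA -expr2; apply: le_lt_trans K2b _.
    by rewrite invfM; move: Kinv; lra.
  apply: le_trans.
  have -> : (K^-1 - K * b) * ((1 - eta) * K * x) = (1 - K ^+ 2 * b) * (1 - eta) * x.
    by field.
  rewrite ler_pM2r //.
  move: K2b eta_small; rewrite !invfM; move: Kinv (K ^+ 2 * b) => + c.
  have : 0 < K^-1 by rewrite invr_gt0.
  move: (K^-1) => d; nra.
have Bern (u : R) : u = (8 * K)^-1 -> 7 / 8 <= (1 - u) ^+ k.+1.
  move=> uE; have : 0 <= 1 - u.
    by rewrite uE invfM; move: Kinv; lra.
  move=> /(@expr_ge_tangent R 1 (1 - u) k ler01); apply: le_trans.
  rewrite !expr1n mulr1 -KE uE.
  have -> : K * (1 - (8 * K)^-1 - 1) = - 8^-1 by field.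
  lra.
have sumS : (\sum_i #|S i| + #|Z| = n)%N.
  rewrite -[RHS]card_ord -(cardsC (\bigcup_i S i)); congr (_ + _)%N.
  rewrite -sum1_card partition_disjoint_bigcup //=.
  by apply: eq_bigr => i _; rewrite sum1_card.
have u0 : 0 <= 1 - (8 * K)^-1 by rewrite invfM; move: Kinv; lra.
(* Multiplied over [i], the bounds for a nonempty [Z] would give [7 / 8 <= (3 / 4) ^+ #|Z|], as
   [h ^+ k.+1 <= 3 / 2]. *)
have Z0 : #|Z| = 0%N.
  case: (posnP #|Z|) => // Zpos; exfalso.
  have : 7 / 8 * 2 ^+ n <= 2 ^+ (\sum_i #|S i|)%N * (3 / 2) ^+ #|Z| :> R.
    apply: le_trans (_ : ((1 - (8 * K)^-1) * x) ^+ k.+1 <= _).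
      by rewrite exprMn xE ler_pM2r ?exprn_gt0 //; exact: Bern.
    apply: le_trans (_ : \prod_i (2 ^+ #|S i| * h ^+ #|Z|) <= _).
      rewrite -[X in _ ^+ X <= _](card_ord k.+1) -[leLHS]prodr_const; apply: ler_prod => i _.
      by rewrite mulr_ge0 ?(ltW x0) //= (le_trans (Plow i)).
    rewrite big_split /= prodr_const card_ord -exprM mulnC exprM.
    rewrite prodrXr ler_pM2l ?exprn_gt0 // ler_pXn2r ?nnegrE ?divr_ge0 //.
      by rewrite /h KE; exact: expR_constant.
    by rewrite exprn_ge0 // mulr_ge0 ?addr_ge0 ?expR_ge0.
  rewrite -[X in 2 ^+ X]sumS exprD mulrCA ler_pM2l ?exprn_gt0 //.
  case: #|Z| Zpos => // z _; apply/negP; rewrite -ltNge !exprS.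
  have : (3 / 2) ^+ z <= 2 ^+ z :> R by rewrite lerXn2r ?nnegrE //; lra.
  have : 0 < 2 ^+ z :> R by rewrite exprn_gt0.
  move: ((3 / 2) ^+ z) (2 ^+ z) => p q; lra.
(* By integrality a deficit is at least one, which would give [7 / 8 * 2 ^+ n <= 2 ^+ n / 2]. *)
have Scard i : (n <= k.+1 * #|S i|)%N.
  rewrite leqNgt; apply/negP => lt_n.
  have := Pup i; rewrite Z0 expr0 mulr1 => /(le_trans (Plow i)) leS.
  have : ((1 - (8 * K)^-1) * x) ^+ k.+1 <= (2 ^+ #|S i|) ^+ k.+1.
    by rewrite lerXn2r // nnegrE ?exprn_ge0 // mulr_ge0 // ltW.
  rewrite exprMn xE -exprM mulnC; apply/negP; rewrite -ltNge.
  apply: lt_le_trans (_ : 7 / 8 * 2 ^+ n <= _); last first.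
    by rewrite ler_pM2r ?exprn_gt0 //; exact: Bern.
  have : 2 ^+ (k.+1 * #|S i|).+1 <= 2 ^+ n :> R by rewrite ler_eXn2l // ltr1n.
  have : 0 < 2 ^+ (k.+1 * #|S i|) :> R by rewrite exprn_gt0.
  rewrite exprS; move: (2 ^+ _) (2 ^+ n) => p q; lra.
exists S; split=> //.
- by rewrite -[LHS]setCK -/Z (cards0_eq Z0) setC0.
(* No size is below the average [n / k.+1], so every size equals it. *)
- move=> i; apply/eqP; rewrite eqn_leq Scard andbT.
  have : (\sum_(j | j != i) n <= \sum_(j | j != i) k.+1 * #|S j|)%N.
    by apply: leq_sum => j _; exact: Scard.
  rewrite sum_nat_const cardC1 card_ord /= => le_rest.
  have : (k.+1 * #|S i| + \sum_(j | j != i) k.+1 * #|S j| = k.+1 * n)%N.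
    by rewrite -[in RHS]sumS Z0 addn0 big_distrr [RHS](bigD1 i).
  by move=> sumE; rewrite -(leq_add2r (k * n)) -mulSn -sumE leq_add2l.
have Pdis i j : i != j -> [disjoint P i & P j].
  move=> ij; apply: disjointWl (subsetDl _ _) _; apply: disjointWr (subsetDl _ _) _.
  exact: Qdis.
have : #|[set v | ~~ [exists i, f v \subset S i]]|%:R <= m - \sum_i #|P i|%:R.
  rewrite lerBrDr -natr_sum -natrD ler_nat.
  have -> : (\sum_i #|P i| = #|\bigcup_i P i|)%N.
    rewrite -sum1_card partition_disjoint_bigcup //=.
    by apply: eq_bigr => i _; rewrite sum1_card.
  rewrite -(cardsC (\bigcup_i P i)) addnC leq_add2l; apply: subset_leq_card.
  apply/subsetP => v; rewrite !inE; apply: contra => /bigcupP[i _ /Psub].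
  by rewrite (cards0_eq Z0) setU0 => vi; apply/existsP; exists i.
move/le_trans; apply.
have : \sum_(i < k.+1) (K^-1 - K * b) * m <= \sum_i #|P i|%:R.
  by apply: ler_sum => i _; exact: Plarge.
rewrite sumr_const card_ord -[_ *+ _]mulr_natl -KE.
have -> : K * ((K^-1 - K * b) * m) = (1 - K ^+ 2 * b) * m by field.
lra.
Qed.

End Cubes.

(** * Stability for disjoint pairs: choice of the parameters *)

Local Notation member F := {A | A \in F}.

(* The pair {A, B} has two orderings, except when A = B = set0. *)
Lemma dp_le_arcs n (F : {set {set 'I_n}}) :
  (2 * dp F <= (arcs (disj_rel (val : member F -> {set 'I_n})) setT setT).+1)%N.
Proof.
set e := disj_rel _.
pose E := [set p : member F * member F | e p.1 p.2].
pose g (p : member F * member F) := [set val p.1; val p.2].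
have -> : arcs e setT setT = #|E|.
  rewrite /arcs pair_big -sum1_card big_mkcond [RHS]big_mkcond /=.
  by apply: eq_bigr => p _; rewrite !inE /=; case: (e _ _).
have -> : dp F = #|g @: E|.
  apply: eq_card => P; rewrite inE; apply/exists_inP/imsetP.
    move=> [A AF /exists_inP[B BF /andP[AB /eqP ->]]].
    by exists (exist _ A AF, exist _ B BF); rewrite ?inE.
  move=> [[[A AF] [B BF]]]; rewrite inE /e /disj_rel /= => AB ->.
  by exists A => //; apply/exists_inP; exists B; rewrite ?AB ?eqxx.
rewrite -[#|E|]sum1_card (partition_big_imset g) /= mulnC -sum_nat_const.
apply: leq_trans (_ : \sum_(P in g @: E)
    ((P == [set set0]) + \sum_(p in E | g p == P) 1) <= _)%N; last first.
  rewrite big_split /= -[leqRHS]add1n leq_add2r -big_mkcondr sum1_card.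
  rewrite -(cards1 ([set set0] : {set {set 'I_n}})); apply: subset_leq_card.
  by apply/subsetP => P; rewrite unfold_in !inE => /andP[].
apply: leq_sum => _ /imsetP[[a c] acE ->].
rewrite sum1_card; have [ac|ac] := eqVneq a c.
  have a0 : val a = set0.
    by move: acE; rewrite inE /e /disj_rel /= ac -setI_eq0 setIid => /eqP.
  rewrite /g /= -ac a0 setUid eqxx; apply: (@leq_add 1 1) => //; apply/card_gt0P.
  by exists (a, c); rewrite unfold_in /= acE /g /= -ac a0 setUid eqxx.
apply: leq_trans (leq_addl _ _).
have <- : #|[set (a, c); (c, a)]| = 2%N.
  by rewrite cards2 xpair_eqE negb_and ac.
apply: subset_leq_card; apply/subsetP => p; rewrite in_set2 => pE; rewrite unfold_in.
case/orP: pE => /eqP -> /=.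
  by rewrite acE eqxx.
have -> : (c, a) \in E by move: acE; rewrite !inE /e /disj_rel disjoint_sym.
by rewrite /g /= setUC eqxx.
Qed.

(** The parameters are fixed in the order [b], [w], then [eta] and [tau]. The threshold returned is
    [eta / 2]; the other half absorbs the extra 1 in [dp_le_arcs]. The number of cubes is [k.+1]. *)
Lemma disjoint_pairs_stability (R : realType) (eps : R) k : 0 < eps -> (0 < k)%N ->
  exists2 eta : R, 0 < eta & exists n0, forall n, (n0 <= n)%N ->
  forall (F : {set {set 'I_n}}) (x : R), 0 < x -> x ^+ k.+1 = 2 ^+ n ->
    (1 - eta) * k.+1%:R * x <= #|F|%:R ->
    (1 - k.+1%:R^-1 - eta) * #|F|%:R ^+ 2 / 2 <= (dp F)%:R ->
  (k.+1 %| n)%N /\ exists S : 'I_k.+1 -> {set 'I_n},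
    balanced_partition S /\ #|F :\: cube_series S|%:R <= eps * #|F|%:R.
Proof.
move=> eps0 k0; pose K : R := k.+1%:R.
have KE : K = k.+1%:R by [].
have K2 : 2 <= K by rewrite ler_nat.
clearbody K; have K0 : 0 < K by lra.
have Kn0 : K != 0 by rewrite gt_eqF.
(* The 1 in the minimum gives [b_small]; the [eps] gives [K ^+ 2 * b <= eps], the exceptional
   proportion in [exists_cube_partition]. *)
pose b := Num.min eps 1 / (72 * K ^+ 3).
have K3 : 0 < 72 * K ^+ 3 by rewrite mulr_gt0 // exprn_gt0.
have b0 : 0 < b by rewrite divr_gt0 // lt_min eps0 ltr01.
have b_small : b <= (72 * K ^+ 3)^-1.
  by rewrite ler_pdivrMr // mulVf ?gt_eqF // ge_min lexx orbT.
have b_le1 : b <= (72 * K)^-1.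
  apply: le_trans b_small _; rewrite lef_pV2 ?posrE ?mulr_gt0 // ler_pM2l //.
  by rewrite -[leLHS]expr1 ler_weXn2l //; lra.
have b_eps : K ^+ 2 * b <= eps.
  apply: le_trans (_ : K ^+ 2 * (eps / (72 * K ^+ 3)) <= _).
    by rewrite ler_pM2l ?exprn_gt0 // ler_pM2r ?invr_gt0 // ge_min lexx.
  have -> : K ^+ 2 * (eps / (72 * K ^+ 3)) = eps * (72 * K)^-1 by field.
  rewrite -[leRHS]mulr1 ler_pM2l // invf_le1 ?mulr_gt0 //; lra.
(* [near_turan_partition] asks for [eta + (2 * K + 6) * w <= b ^+ 2], and [eta <= w] will hold. *)
pose w := b ^+ 2 / (2 * K + 7).
have K7 : 0 < 2 * K + 7 by lra.
have w0 : 0 < w by rewrite divr_gt0 // exprn_gt0.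
have wE : (2 * K + 7) * w = b ^+ 2 by rewrite /w mulrC divfK ?gt_eqF.
have w_le : w <= (72 * K)^-1.
  apply: le_trans (b_le1).
  have b1 : b <= 1.
    apply: le_trans b_le1 _; rewrite invf_le1 ?mulr_gt0 //; lra.
  nra.
(* [eta] and [tau] make each of the two summands of [w] in [near_turan_partition] equal to
   [w / 2]. *)
pose eta := w / (2 * K ^+ 2).
have eta0 : 0 < eta by rewrite divr_gt0 // mulr_gt0 // exprn_gt0.
have etaE : K ^+ 2 * eta = w / 2 by rewrite /eta; field.
pose tau := w / (4 * K * (2 * K) ^+ k.+1).
have KK0 : 0 < (2 * K) ^+ k.+1 by rewrite exprn_gt0 // mulr_gt0.
have tau0 : 0 < tau by rewrite divr_gt0 // !mulr_gt0.
have tauE : 2 * K * tau * (2 * K) ^+ k.+1 = w / 2.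
  by rewrite /tau; field; rewrite Kn0 gt_eqF.
have Kinv : K^-1 <= 1 / 2 by rewrite mul1r lef_pV2 ?posrE.
have Kinv0 : 0 < K^-1 by rewrite invr_gt0.
have eta_w : eta <= w.
  have : 1 <= K ^+ 2 by nra.
  nra.
have eta_le : eta <= (16 * K)^-1.
  apply: le_trans eta_w _; apply: le_trans w_le _.
  by rewrite !invfM; move: Kinv Kinv0; move: (K^-1) => c; lra.
have eta_half : eta <= 1 / 2.
  by apply: le_trans eta_le _; rewrite invfM; move: Kinv Kinv0; move: (K^-1) => c; lra.
have [n1 few] := few_avoiding_cliques k.+2 (ltn0Sn k) tau0.
(* [n >= B ^ k.+1] forces [#|V| > B], as [#|V| ^ k.+1 >= 2 ^ n > n]; then
   [eta / 2 * m ^+ 2 >= 1]. *)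
pose B := Num.bound (2 / eta).
exists (eta / 2); first by rewrite divr_gt0.
exists (maxn n1 (B ^ k.+1)) => n; rewrite geq_max => /andP[/few{}few le_n] F x x0 xE.
pose V : finType := member F; pose f : V -> {set 'I_n} := val.
have f_inj : injective f by exact: val_inj.
have cardV : #|V| = #|F| by rewrite card_sig.
rewrite -cardV -KE => m_large dp_large; set m : R := #|V|%:R in m_large dp_large *.
have x_le : x <= m.
  apply: le_trans m_large; rewrite ler_peMl ?(ltW x0) //.
  nra.
have m0 : 0 < m by exact: lt_le_trans x_le.
have V0 : (0 < #|V|)%N by rewrite -(ltr0n R).
have V_large : (2 ^ n <= #|V| ^ k.+1)%N.
  by rewrite -(ler_nat R) !natrX -xE lerXn2r // nnegrE ltW.
have m_eta : 1 <= eta / 2 * m ^+ 2.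
  have B_le : (B < #|V|)%N.
    rewrite -(@ltn_exp2r _ _ k.+1) //; apply: leq_trans V_large.
    by apply: leq_ltn_trans le_n _; rewrite ltn_expl.
  have : 2 / eta <= m.
    apply: le_trans (ltW (archi_boundP _)) _; first by rewrite divr_ge0 // ltW.
    by rewrite ler_nat ltnW.
  rewrite ler_pdivrMr // => m_eta.
  have : 1 <= m by rewrite ler1n.
  nra.
have dense : (1 - k.+1%:R^-1 - eta) * m ^+ 2 <= (arcs (disj_rel f) setT setT)%:R.
  have : 2 * (dp F)%:R <= (arcs (disj_rel f) setT setT)%:R + 1 :> R.
    by rewrite natr1 -natrM ler_nat; exact: dp_le_arcs.
  by rewrite -KE; move: dp_large m_eta; move: (K^-1) => c; lra.
have fewK : (ncliques (disj_rel f) k.+2)%:R <= tau * m ^+ k.+2.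
  rewrite -card_avoiding_cliques0; apply: few => //.
  by rewrite cards0 add0n mulnC ltn_ceil.
have [||Q [Qdis Qlarge Qdense]] := near_turan_partition (disj_rel_sym f) k0 V0
    (ltW tau0) (ltW eta0) _ (ltW b0) _ dense fewK.
- by rewrite -KE etaE; move: w_le; rewrite invfM; move: Kinv Kinv0; move: (K^-1) => c; lra.
- by rewrite -!KE etaE tauE -wE; lra.
have [] := exists_cube_partition f_inj b0 _ _ x0 xE _ Qdis Qlarge Qdense (eta := eta / 2);
  rewrite -?KE //; first by apply: le_trans eta_le; lra.
move=> S [Sdis Scov Scard Smiss].
have cardS i : #|S i| = (n %/ k.+1)%N by rewrite -[X in (X %/ _)%N](Scard i) mulKn.
split; first by rewrite -[X in (_ %| X)%N](Scard ord0) dvdn_mulr.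
exists S; split.
  by split=> //; split=> // i; rewrite cardS leqnn leq_div2r // addnS subn1 leq_addr.
apply: le_trans (_ : K ^+ 2 * b * m <= _); last by rewrite ler_pM2r.
apply: le_trans Smiss; rewrite ler_nat -(card_imset _ f_inj).
apply: subset_leq_card; apply/subsetP => A; rewrite inE => /andP[nA AF].
apply/imsetP; exists (exist _ A AF) => //; rewrite inE; apply: contra nA.
by move=> /existsP[i Ai]; apply/bigcupP; exists i => //; rewrite powersetE.
Qed.

(* Transfer to the standard real numbers *)
Local Close Scope ring_scope.
From mathcomp Require Import Rstruct.
From Stdlib Require Import Reals.

(** Identifies the real power as the root [x] that [disjoint_pairs_stability] takes. *)
Lemma Rpower2_div_pow n k : (0 < k)%N -> (Rpower 2 (INR n / INR k) ^ k = 2 ^ n)%R.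
Proof.
move=> k0; have kn0 : INR k <> 0%R by apply: not_0_INR; case: k k0.
rewrite -Rpower_pow; last exact: exp_pos.
rewrite Rpower_mult -Rpower_pow; last exact: Rlt_0_2.
by congr Rpower; rewrite /Rdiv Rmult_assoc Rinv_l // Rmult_1_r.
Qed.

Theorem theorem1p5 :
  forall (eps : R), (0 < eps)%R ->
  forall k : nat, (2 <= k)%N ->
  exists eta : R, (0 < eta)%R /\
  exists N : nat, forall n : nat, (N <= n)%N ->
  forall F : {set {set 'I_n}},
    (INR #|F| >= (1 - eta) * INR k * Rpower 2 (INR n / INR k))%R ->
    (INR (dp F) >= (1 - 1 / INR k - eta) * (INR #|F| ^ 2) / 2)%R ->
    (k %| n)%N /\
    exists S : 'I_k -> {set 'I_n},
      balanced_partition S /\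
      (INR #|F :\: cube_series S| <= eps * INR #|F|)%R.
Proof.
move=> eps eps0 [//|k] k0.
have [eta eta0 [n0 stab]] := disjoint_pairs_stability (introT RltP eps0) k0.
exists eta; split; first exact/RltP.
exists n0 => n /stab{}stab F m_large dp_large.
have x0 : (0 < Rpower 2 (INR n / INR k.+1))%R by exact: exp_pos.
have xE := @Rpower2_div_pow n k.+1 isT.
have [||||divn [S [Sbal Sle]]] := stab F (Rpower 2 (INR n / INR k.+1)).
- exact/RltP.
- by rewrite -!RpowE xE.
- by apply/RleP; move: (Rge_le _ _ m_large); rewrite !INRE.
- apply/RleP; move: (Rge_le _ _ dp_large).
  by rewrite !INRE RpowE /Rdiv Rmult_1_l.
split=> //; exists S; split=> //.
by rewrite !INRE; exact/RleP.
Qed.
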